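(* For any two integers $p\ge 2$ and $n\ge 1$, the Sierpiński graph $S_p^n$ satisfies $\tau(S_p^n)=p^{n-1}(p-2)$.
   Context: All graphs are simple, finite and undirected. For a graph $G$, a set $X\subseteq V(G)$ is a feedback vertex set of $G$ if $G-X$ (the graph obtained by deleting the vertices of $X$ and all edges incident to them) is a forest; the feedback vertex number $\tau(G)$ is the minimum cardinality of a feedback vertex set of $G$. For an integer $p\ge 1$ let $P=\{0,1,\ldots,p-1\}$, let $[n]=\{1,\ldots,n\}$, and let $P^n$ be the set of all $n$-tuples over $P$, written as words of length $n$ ($P^0$ consists of the empty word only); $j^{m}$ denotes the word consisting of $m$ copies of $j$. For integers $p\ge 1$, $n\ge 0$, the Sierpiński graph $S_p^n$ is given by $V(S_p^n)=P^n$ and $$E(S_p^n)=\{\{\underline{s}ij^{d-1},\underline{s}ji^{d-1}\} \mid i,j\in P,\ i\ne j,\ d\in[n],\ \underline{s}\in P^{n-d}\}.$$ *)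

(* Defs.v *)
From mathcomp Require Import all_boot.
Set Implicit Arguments.
Unset Strict Implicit.
Unset Printing Implicit Defensive.

Record sgraph := SGraph {
  vertex :> finType;
  adj : rel vertex;
  adj_sym : symmetric adj;
  adj_irrefl : irreflexive adj
}.

Arguments adj {G} : rename.

Section Deletion.
Variables (G : sgraph) (X : {set G}).

Definition del_vertex := {x : G | x \notin X}.

Definition del_adj : rel del_vertex := fun x y => adj (val x) (val y).

Lemma del_adj_sym : symmetric del_adj.
Proof. by move=> x y; apply: adj_sym. Qed.

Lemma del_adj_irrefl : irreflexive del_adj.
Proof. by move=> x; apply: adj_irrefl. Qed.

Definition delete : sgraph := SGraph del_adj_sym del_adj_irrefl.

End Deletion.

(* A graph cycle is a [ucycle] of length at least 3: [ucycle] also accepts the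
   empty sequence and, for an edge xy, the sequence [:: x; y].  The length is
   bounded by #|G| only to make the predicate boolean; see [forestP]. *)
Definition forest (G : sgraph) : bool :=
  [forall k : 'I_#|G|.+1, forall c : k.-tuple G, ~~ ((2 < k) && ucycleb adj c)].

Lemma forestP (G : sgraph) :
  reflect (forall c : seq G, 2 < size c -> ~ ucycle adj c) (forest G).
Proof.
apply: (iffP 'forall_forallP) => [fG c c2 cc | fG k c]; last first.
  apply/negP => /andP[k2 cc]; apply: (fG c); first by rewrite size_tuple.
  exact: cc.
have ck : size c < #|G|.+1.
  by rewrite ltnS; case/andP: cc => _ /card_uniqP <-; apply: max_card.
by move/negP: (fG (Ordinal ck) (in_tuple c)); apply; rewrite c2.
Qed.

Definition feedback_vertex_set (G : sgraph) (X : {set G}) : bool :=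
  forest (delete X).

Lemma feedback_vertex_setT (G : sgraph) : feedback_vertex_set [set: G].
Proof.
apply/forestP => -[//|[x px] c] _ _.
by rewrite inE in px.
Qed.

Definition feedback_vertex_number (G : sgraph) : nat :=
  #|[arg min_(X < [set: G] | feedback_vertex_set X) #|X| ]|.

Lemma feedback_vertex_numberP (G : sgraph) (k : nat) :
  feedback_vertex_number G = k <->
  (exists2 X : {set G}, feedback_vertex_set X & #|X| = k) /\
  (forall X : {set G}, feedback_vertex_set X -> k <= #|X|).
Proof.
rewrite /feedback_vertex_number.
case: arg_minnP => [|X fX minX]; first exact: feedback_vertex_setT.
split=> [<- | [[Y fY <-] minY]]; first by split=> //; exists X.
by apply/eqP; rewrite eqn_leq minX ?minY.
Qed.

Section Sierpinski.
Variables p n : nat.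

Definition sierpinski_adj : rel (n.-tuple 'I_p) := fun u v =>
  [exists i : 'I_p, exists j : 'I_p, exists d : 'I_n.+1,
   exists s : (n - d).-tuple 'I_p,
    [&& i != j, 1 <= d,
        val u == s ++ i :: nseq (d - 1) j & val v == s ++ j :: nseq (d - 1) i]].

Lemma sierpinski_adj_sym : symmetric sierpinski_adj.
Proof.
suff sub u v : sierpinski_adj u v -> sierpinski_adj v u.
  by move=> u v; apply/idP/idP; apply: sub.
case/existsP=> i /existsP[j /existsP[d /existsP[s /and4P[ij d1 uE vE]]]].
apply/existsP; exists j; apply/existsP; exists i.
apply/existsP; exists d; apply/existsP; exists s.
by rewrite eq_sym ij d1 vE uE.
Qed.

Lemma sierpinski_adj_irrefl : irreflexive sierpinski_adj.
Proof.
move=> u; apply/negbTE/negP.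
case/existsP=> i /existsP[j /existsP[d /existsP[s /and4P[ij _ /eqP-> ]]]].
by rewrite eqseq_cat // eqseq_cons (negPf ij) andbF.
Qed.

Definition sierpinski : sgraph :=
  SGraph sierpinski_adj_sym sierpinski_adj_irrefl.

End Sierpinski.

(* Main.v *)
Require Import Defs.
From mathcomp Require Import all_boot zify.
Set Implicit Arguments.
Unset Strict Implicit.
Unset Printing Implicit Defensive.

(** Fixing the first [n - 1] letters and varying the last one partitions
    [S_p^n] into [p ^ (n - 1)] cliques of order [p].  A forest contains no
    triangle, so a feedback vertex set leaves at most two vertices of each
    clique; this is the lower bound ([fvs_fibre_card]).

    For the upper bound, delete the words whose last letter is at least 2, which
    leaves exactly two vertices of each clique.  In an edge between [s i j^k] and
    [s j i^k] the last letters of the two ends are [i] and [j] in some order, so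
    an edge survives only if [{i, j} = {0, 1}]: it then joins [s 0 1^k] to
    [s 1 0^k], which is the addition of 1 with carry in binary
    ([kept_adj_binary_succ]).  Read as binary numerals (letters above 1 being
    admitted as digits), the two ends have consecutive values, and the upper end
    is determined by the lower one.  Hence there is no cycle, since a vertex of
    minimal value on it would have two distinct upper neighbours
    ([forest_of_rank]). *)

(** * Forests and feedback vertex sets *)

(** On a cycle, the two neighbours of a vertex of minimal rank are distinct and
    both have a larger rank. *)
Lemma forest_of_rank (G : sgraph) (f : G -> nat) :
  (forall x y : G, adj x y -> f x != f y) ->
  (forall x y z : G, adj x y -> adj x z -> f x < f y -> f x < f z -> y = z) ->
  forest G.
Proof.
move=> f_adj f_up; apply/forestP => c c_gt2 c_cyc.
have [x0 x0c] : exists x0, x0 \in c.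
  by case: c c_gt2 {c_cyc} => // x0 c _; exists x0; rewrite mem_head.
case: (arg_minnP f x0c) => x xc x_min.
have [i c' c'E] := rot_to xc.
have c'_min y : y \in c' -> f x <= f y.
  by move=> yc'; apply: x_min; change (y \in c); rewrite -(mem_rot i) c'E inE yc' orbT.
have : ucycle adj (x :: c') by rewrite -c'E rot_ucycle.
have : 2 < size (x :: c') by rewrite -c'E size_rot.
case: c' c'_min {c'E} => [|y [|z c']] // c'_min _ /andP[].
rewrite /= rcons_path => /and4P[xy _ _ lx] /and3P[_ y_notin _].
have {}lx : adj x (last z c') by rewrite adj_sym.
have up t : adj x t -> t \in [:: y, z & c'] -> f x < f t.
  by move=> xt tc; rewrite ltn_neqAle f_adj //= c'_min.
have lE : y = last z c'.
  by apply: (f_up x) => //; apply: up; rewrite // inE ?eqxx // mem_last orbT.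
by rewrite lE mem_last in y_notin.
Qed.

Lemma fvs_triangle (G : sgraph) (X : {set G}) (x y z : G) :
  feedback_vertex_set X -> adj x y -> adj y z -> adj z x ->
  [|| x \in X, y \in X | z \in X].
Proof.
move=> /forestP fX xy yz zx; apply: contraT; rewrite !negb_or => /and3P[xX yX zX].
have neq u v : adj u v -> u != v :> G.
  by apply: contraL => /eqP->; rewrite adj_irrefl.
have sub_inj (u v : G) (uX : u \notin X) (vX : v \notin X) :
  (exist _ u uX == exist _ v vX :> delete X) = (u == v) by rewrite -val_eqE.
case: (fX [:: exist _ x xX; exist _ y yX; exist _ z zX]) => //.
apply/andP; split; first by rewrite /= /del_adj /= xy yz zx.
by rewrite /= !inE !sub_inj (eq_sym x z) !negb_or !neq.
Qed.

(** * Fibres over the first letters *)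

Lemma card_tuple_rcons (T : finType) (m : nat) (A : {set m.+1.-tuple T}) :
  #|A| = \sum_(s : m.-tuple T) #|[set i | rcons_tuple s i \in A]|.
Proof.
pose h (si : m.-tuple T * T) := rcons_tuple si.1 si.2.
have h_bij : bijective h.
  apply: inj_card_bij; last by rewrite card_prod !card_tuple expnSr.
  case=> s i [t j] /(congr1 val) /rcons_inj[st ->].
  by congr (_, _); apply: val_inj.
rewrite -sum1_card (reindex h) /=; last exact: onW_bij.
rewrite (eq_bigr (fun s => \sum_(i | rcons_tuple s i \in A) 1)).
  by rewrite pair_big_dep.
by move=> s _; rewrite -sum1_card; apply: eq_bigl => i; rewrite inE.
Qed.

Lemma sierpinski_fibre_adj (p m : nat) (s : m.-tuple 'I_p) (i j : 'I_p) :
  i != j ->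
  sierpinski_adj (rcons_tuple s i) (rcons_tuple s j).
Proof.
move=> ij; have sP : size s == m.+1 - 1 by rewrite size_tuple subn1.
apply/existsP; exists i; apply/existsP; exists j.
apply/existsP; exists (Ordinal (isT : 1 < m.+2)).
by apply/existsP; exists (Tuple sP); rewrite ij /= !cats1 !eqxx.
Qed.

Lemma fvs_fibre_card (p m : nat) (X : {set sierpinski p m.+1})
    (s : m.-tuple 'I_p) :
  feedback_vertex_set X ->
  p - 2 <= #|[set i | rcons_tuple s i \in X]|.
Proof.
move=> fX; set A := [set i | _].
suff : #|~: A| <= 2 by have := cardsC A; rewrite card_ord; lia.
rewrite leqNgt; apply/negP => /card_gt2P[i [j [k [[]]]]].
rewrite !inE => iX jX kX [ij jk ki].
have := fvs_triangle fX (sierpinski_fibre_adj s ij) (sierpinski_fibre_adj s jk)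
  (sierpinski_fibre_adj s ki).
by rewrite (negPf iX) (negPf jX) (negPf kX).
Qed.

(** * Binary succession of words *)

(** The prefix [s] is arbitrary because the remaining vertices are restricted in
    their last letter only. *)
Definition binary_succ (u v : seq nat) : Prop :=
  exists s k, u = s ++ 0 :: nseq k 1 /\ v = s ++ 1 :: nseq k 0.

Definition binary_value : seq nat -> nat := foldl (fun a x => a.*2 + x) 0.

Lemma binary_value_succ u v :
  binary_succ u v -> binary_value v = (binary_value u).+1.
Proof.
case=> s [k [-> ->]]; rewrite /binary_value !foldl_cat /=.
set a := foldl _ 0 s; rewrite addn0 addn1.
by elim: k a.*2 => //= k IHk b; rewrite addn0 addn1 doubleS IHk.
Qed.

(** The block of trailing 1s of [u] determines where the carry stops. *)
Lemma binary_succ_fun u v w : binary_succ u v -> binary_succ u w -> v = w.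
Proof.
case=> s [k [uE ->]] [t [l [uE' ->]]].
have index0 r m : index 0 (rev (r ++ 0 :: nseq m 1)) = m.
  rewrite rev_cat rev_cons rev_nseq cat_rcons index_cat mem_nseq andbF.
  by rewrite size_nseq /= addn0.
have kl : k = l by rewrite -(index0 s k) -uE uE' index0.
have st : size s = size t.
  by have := congr1 size uE; rewrite uE' kl !size_cat /= !size_nseq; lia.
move: uE'; rewrite uE kl => /eqP; rewrite eqseq_cat // eqxx andbT.
by move/eqP->.
Qed.

(** * The vertices left by the optimal set *)

Definition letters (p n : nat) (u : n.-tuple 'I_p) : seq nat := map val u.

Definition high_last (p n : nat) : {set sierpinski p n} :=
  [set u : n.-tuple 'I_p | 1 < last 0 (letters u)].

Lemma kept_adj_binary_succ (p n : nat) (u v : sierpinski p n) :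
  u \notin high_last p n -> v \notin high_last p n -> adj u v ->
  binary_succ (letters u) (letters v) \/ binary_succ (letters v) (letters u).
Proof.
rewrite !inE -!leqNgt => uX vX.
case/existsP=> i /existsP[j /existsP[d /existsP[s /and4P[ij d1 /eqP uE /eqP vE]]]].
have lE (w : n.-tuple 'I_p) (a b : 'I_p) : val w = s ++ a :: nseq (d - 1) b ->
    letters w = map val s ++ val a :: nseq (d - 1) (val b).
  by rewrite /letters => ->; rewrite map_cat /= map_nseq.
have {uE}uE := lE u _ _ uE; have {lE vE}vE := lE v _ _ vE.
have last_nseq (a b k : nat) : last a (nseq k b) = if k is 0 then a else b.
  by elim: k a => //= k IHk a; rewrite IHk; case: k {IHk}.
have {uX vX}[i1 j1] : i <= 1 /\ j <= 1.
  by move: uX vX; rewrite uE vE !last_cat /= !last_nseq; case: (d - 1).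
rewrite uE vE; move: ij i1 j1; rewrite -val_eqE /=.
case: (nat_of_ord i) => [|[|//]]; case: (nat_of_ord j) => [|[|//]] // _ _ _.
  by left; do 2!eexists.
by right; do 2!eexists.
Qed.

Lemma high_last_fvs (p n : nat) : feedback_vertex_set (high_last p n).
Proof.
pose f (x : delete (high_last p n)) := binary_value (letters (val x)).
have adjP (x y : delete (high_last p n)) : adj x y ->
    binary_succ (letters (val x)) (letters (val y)) \/
    binary_succ (letters (val y)) (letters (val x)).
  by case: x y => [x xX] [y yX]; apply: kept_adj_binary_succ.
have upP x y : adj x y -> f x < f y ->
    binary_succ (letters (val x)) (letters (val y)).
  by case/adjP=> // /binary_value_succ; rewrite /f; lia.
apply: (@forest_of_rank _ f) => [x y | x y z xy xz fxy fxz].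
  by case/adjP=> /binary_value_succ; rewrite /f; lia.
have yzE := binary_succ_fun (upP _ _ xy fxy) (upP _ _ xz fxz).
by do 2!apply: val_inj; apply: (inj_map val_inj).
Qed.

Lemma high_last_card (p m : nat) :
  2 <= p -> #|high_last p m.+1| = p ^ m * (p - 2).
Proof.
move=> hp; rewrite card_tuple_rcons.
rewrite (eq_bigr (fun=> p - 2)) => [|s _].
  by rewrite sum_nat_const card_tuple card_ord.
have -> : [set i | rcons_tuple s i \in high_last p m.+1]
        = ~: [set Ordinal (ltnW hp); Ordinal hp].
  apply/setP=> i; rewrite !inE /letters /= map_rcons last_rcons -!val_eqE /=.
  by case: (nat_of_ord i) => [|[]].
by rewrite cardsCs setCK card_ord cards2.
Qed.

Theorem theorem2p4 (p n : nat) (hp : 2 <= p) (hn : 1 <= n) :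
  feedback_vertex_number (sierpinski p n) = p ^ (n - 1) * (p - 2).
Proof.
case: n hn => // m _; rewrite subn1 /=.
apply/feedback_vertex_numberP; split.
  by exists (high_last p m.+1); [apply: high_last_fvs | apply: high_last_card].
move=> X fX; rewrite card_tuple_rcons.
have -> : p ^ m * (p - 2) = \sum_(s : m.-tuple 'I_p) (p - 2).
  by rewrite sum_nat_const card_tuple card_ord.
by apply: leq_sum => s _; apply: fvs_fibre_card.
Qed.
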